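(* Let $d\ge 2$ and let $P$ be the irreducible stochastic transition matrix of a periodic Markov chain, of the block-cyclic form $$P=\begin{bmatrix} 0 & 0 & \cdots & 0 & A_d \\ A_1 & 0 & \cdots & 0 & 0 \\ 0 & A_2 & \ddots & & \vdots \\ \vdots & \ddots & \ddots & 0 & \vdots \\ 0 & \cdots & 0 & A_{d-1} & 0 \end{bmatrix},$$ a $d\times d$ block matrix whose diagonal blocks are square of sizes $n_1,\dots,n_d$, where the block in position $(i+1,i)$ is the stochastic (possibly rectangular) matrix $A_i$ of size $n_{i+1}\times n_i$ for $1\le i\le d-1$, the block in position $(1,d)$ is the stochastic matrix $A_d$ of size $n_1\times n_d$, and all other blocks are zero. Let $$P_1=A_dA_{d-1}\cdots A_1,\qquad P_2=\begin{bmatrix} 0 & \cdots & \cdots & 0 & A_1A_d \\ A_2 & 0 & & & 0 \\ 0 & A_3 & \ddots & & \vdots \\ \vdots & \ddots & \ddots & 0 & \vdots \\ 0 & \cdots & 0 & A_{d-1} & 0 \end{bmatrix},$$ where $P_2$ is the $(d-1)\times(d-1)$ block matrix with square diagonal blocks of sizes $n_2,\dots,n_d$, subdiagonal blocks $A_2,\dots,A_{d-1}$, top-right block $A_1A_d$, and zero blocks elsewhere (for $d=2$, $P_2=A_1A_2$). Then $$\kappa(P)=\kappa(P_1)+\kappa(P_2)+\frac12.$$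
   Context: A (possibly rectangular) nonnegative matrix $A$ is stochastic if $A\mathbf{1}=\mathbf{1}$, where $\mathbf{1}$ is the all-ones vector of appropriate size. The period of state $i$ of a chain with transition matrix $P$ is the gcd of all $k\ge1$ with $(P^k)_{ii}>0$; the chain is periodic if all periods are at least 2. $P_1$ and $P_2$ are the stochastic complements of $P$ with respect to the partition separating the first block of states from the remaining ones; they are stochastic and irreducible. Kemeny's constant of an irreducible stochastic $N\times N$ matrix $Q$ with eigenvalues $\lambda_1=1,\lambda_2,\dots,\lambda_N$ (with algebraic multiplicity) is $\kappa(Q)=\sum_{i=2}^N\frac{1}{1-\lambda_i}$; equivalently $\kappa(Q)=\operatorname{Tr}\big((I-Q+\mathbf{1}\mathbf{h}^T)^{-1}\big)-1$ for any $\mathbf{h}$ with $\mathbf{h}^T\mathbf{1}=1$. *)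

(* Defs.v *)
From mathcomp Require Import all_boot all_order all_algebra.
From mathcomp Require Import reals complex.

Set Implicit Arguments.
Unset Strict Implicit.
Unset Printing Implicit Defensive.
Import Order.TTheory GRing.Theory Num.Theory.
Local Open Scope ring_scope.

Definition stochastic (R : realType) (m n : nat) (A : 'M[R]_(m, n)) : Prop :=
  (forall i j, 0 <= A i j) /\
  A *m (const_mx 1 : 'cV[R]_n) = (const_mx 1 : 'cV[R]_m).

Definition irreducible (R : realType) (N : nat) (P : 'M[R]_N) : Prop :=
  forall i j : 'I_N, exists k : nat, 0 < (P ^+ k) i j.

(* [g] is the gcd of the (in general infinite) set of return times to [i]. *)
Definition is_period (R : realType) (N : nat) (P : 'M[R]_N) (i : 'I_N)
    (g : nat) : Prop :=
  (forall k : nat, (1 <= k)%N -> 0 < (P ^+ k) i i -> (g %| k)%N) /\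
  (forall e : nat,
     (forall k : nat, (1 <= k)%N -> 0 < (P ^+ k) i i -> (e %| k)%N) ->
     (e %| g)%N).

Definition periodic (R : realType) (N : nat) (P : 'M[R]_N) : Prop :=
  forall i : 'I_N, exists2 g : nat, is_period P i g & (2 <= g)%N.

(* The complex eigenvalues, listed with algebraic multiplicity, in an
   unspecified order. *)
Definition eigenvalues (R : realType) (N : nat) (Q : 'M[R]_N) : seq R[i] :=
  sval (closed_field_poly_normal (char_poly (map_mx (real_complex R) Q))).

(* [rem 1] deletes a single occurrence of the eigenvalue 1. *)
Definition kemeny (R : realType) (N : nat) (Q : 'M[R]_N) : R[i] :=
  \sum_(z <- rem 1 (eigenvalues Q)) (1 - z)^-1.

(* Blocks are numbered from 0: the sizes are [n 0], ..., [n k], the block in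
   position (j+1, j) is [A j] for j < k, and the block in position (0, k) is
   [C].  Values [n i] with i > k and [A j] with j >= k are not used.
   In each branch the dimensions of the block agree propositionally with
   those expected, so [conform_mx 0] is a mere cast. *)
Definition block_cyclic (R : realType) (n : nat -> nat) (k : nat)
    (A : forall j : nat, 'M[R]_(n j.+1, n j)) (C : 'M[R]_(n 0%N, n k)) :
    'M[R]_(\sum_(i < k.+1) n i) :=
  \mxblock_(i < k.+1, j < k.+1)
    (if i == j.+1 :> nat then conform_mx 0 (A j)
     else if (i == 0%N :> nat) && (j == k :> nat) then conform_mx 0 C
     else 0 : 'M[R]_(n i, n j)).

(* The product A_(k-1) ... A_1 A_0. *)
Fixpoint chain_mx (R : realType) (n : nat -> nat)
    (A : forall j : nat, 'M[R]_(n j.+1, n j)) (k : nat) : 'M[R]_(n k, n 0%N) :=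
  if k is k'.+1 then A k' *m chain_mx A k' else 1%:M.

(* Main.v *)
Require Import Defs.
From mathcomp Require Import all_boot all_order all_algebra.
From mathcomp Require Import reals complex.
From mathcomp Require Import ring lra.

(* For a polynomial p with a simple root at 1, the sum of 1/(1 - z) over its
   other roots is p''(1) / (2 p'(1)).  It grows by m when p is multiplied by
   X^m, and becomes c -> m c + (m - 1)/2 under the substitution X -> X^m.
   A block column operation on X - P gives
     chi_P(X) X^((d-1) n_1) = chi_{P1}(X^d) X^(n_2 + ... + n_d),
   and similarly for P2, whose cyclic product A_1 A_d ... A_2 has up to a power
   of X the characteristic polynomial of P1.  Hence all three constants are
   expressed through that of P1, and subtraction leaves 1/2.  Simplicity of the
   eigenvalue 1 of P comes from irreducibility: by the maximum principle the
   drift c in P v = v + c vanishes and harmonic vectors are constant.  The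
   identities of characteristic polynomials transfer simplicity to P1 and P2. *)

Set Implicit Arguments.
Unset Strict Implicit.
Unset Printing Implicit Defensive.
Import Order.TTheory GRing.Theory Num.Theory.
Local Open Scope ring_scope.

(** * Determinants of block matrices *)

Lemma det_scalar_sub_castmx (R : Type) (S : comPzRingType) (f : R -> S)
    (m n : nat) (e : m = n) (x : S) (M : 'M[R]_m) :
  \det (x%:M - map_mx f (castmx (e, e) M)) = \det (x%:M - map_mx f M).
Proof. by case: n / e; rewrite castmx_id. Qed.

(** A division-free Schur complement: right multiplication by the block column [e], [y] clears the
    lower left block. *)
Lemma det_block_mul (S : comPzRingType) (m n : nat) (a : 'M[S]_m) (b : 'M_(m, n))
    (c : 'M_(n, m)) (d : 'M_n) (e : 'M_m) (y : 'M_(n, m)) :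
  c *m e + d *m y = 0 ->
  \det (block_mx a b c d) * \det e = \det (a *m e + b *m y) * \det d.
Proof.
move=> cedy0; have -> : \det e = \det (block_mx e 0 y (1%:M : 'M_n)).
  by rewrite det_lblock det1 mulr1.
rewrite -det_mulmx mulmx_block cedy0 !mulmx0 !mulmx1 !add0r.
by rewrite det_ublock.
Qed.

(** Sylvester's identity: the block matrix with rows [1, V] and [U, x] is reduced by column
    operations in two ways, clearing [V] or clearing [U]. *)
Lemma det_scalar_mulC (S : comPzRingType) (m n : nat) (x : S)
    (U : 'M[S]_(m, n)) (V : 'M[S]_(n, m)) :
  \det (x%:M - V *m U) * x ^+ m = \det (x%:M - U *m V) * x ^+ n.
Proof.
have detM : \det (block_mx 1%:M V U x%:M) = \det (x%:M - U *m V).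
  have detE : \det (block_mx (1%:M : 'M_n) (- V) 0 1%:M) = 1.
    by rewrite det_ublock !det1 mulr1.
  rewrite -[LHS]mulr1 -[X in _ * X]detE -det_mulmx mulmx_block.
  rewrite !(mul0mx, mulmx0, mulmx1, mul1mx, addr0) addNr.
  by rewrite det_lblock det1 mul1r mulmxN addrC.
rewrite -detM -(@det_scalar S n) (@det_block_mul _ _ _ _ _ _ _ _ (- U)).
  by rewrite mul1mx mulmxN det_scalar.
by rewrite mulmxN scalar_mxC subrr.
Qed.

Lemma det_scalar_sub_strict_trig (S : comPzRingType) (m : nat) (x : S) (N : 'M[S]_m) :
  (forall i j : 'I_m, (i <= j)%N -> N i j = 0) -> \det (x%:M - N) = x ^+ m.
Proof.
move=> N0; rewrite det_trig.
  under eq_bigr do rewrite !mxE N0 // eqxx mulr1n subr0.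
  by rewrite prodr_const card_ord.
apply/is_trig_mxP => i j ltij.
by rewrite !mxE N0 1?ltnW // subr0 -val_eqE /= ltn_eqF.
Qed.

(** * Elimination in a block-cyclic matrix *)

Section BlockCyclic.
Variables (R : realType) (S : comPzRingType) (f : {rmorphism R -> S}).
Variables (n : nat -> nat) (k : nat).
Variables (A : forall j : nat, 'M[R]_(n j.+1, n j)) (C : 'M[R]_(n 0%N, n k)).

Definition cyclic_block (i j : 'I_k.+1) : 'M[R]_(n i, n j) :=
  if i == j.+1 :> nat then conform_mx 0 (A j)
  else if (i == 0%N :> nat) && (j == k :> nat) then conform_mx 0 C else 0.
Local Notation B := cyclic_block.

Lemma block_cyclicE : block_cyclic A C = \mxblock_(i < k.+1, j < k.+1) B i j.
Proof. by []. Qed.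

Lemma cyclic_block_strict_trig (i j : 'I_k) :
  (i <= j)%N -> B (lift ord0 i) (lift ord0 j) = 0.
Proof. by move=> leij; rewrite /B /bump /= eqSS ltn_eqF. Qed.

(** Indexing [v] by [nat] rather than by ordinals makes the sizes in [C *m v k] agree without
    casts. *)
Lemma block_cyclic_row0 p (v : forall j : nat, 'M[S]_(n j, p)) :
  \sum_(j < k.+1) map_mx f (B ord0 j) *m v j = map_mx f C *m v k.
Proof.
rewrite big_ord_recr /= big1 ?add0r => [|j _].
  by rewrite /B /= eqxx conform_mx_id.
by rewrite /B /= ltn_eqF // map_mx0 mul0mx.
Qed.

Lemma block_cyclic_rowS p (v : forall j : nat, 'M[S]_(n j, p)) (i : 'I_k) :
  \sum_(j < k.+1) map_mx f (B (lift ord0 i) j) *m v j = map_mx f (A i) *m v i.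
Proof.
rewrite (bigD1 (widen_ord (leqnSn k) i)) //= big1 ?addr0 => [|j].
  by rewrite /B /= eqxx conform_mx_id.
rewrite -val_eqE /= => neij.
by rewrite /B /= /bump /= eqSS eq_sym (negPf neij) map_mx0 mul0mx.
Qed.

Lemma det_block_cyclic (x : S) :
  \det (x%:M - map_mx f (block_cyclic A C)) * x ^+ (k * n 0%N) =
  \det ((x ^+ k.+1)%:M - map_mx f (C *m chain_mx A k)) *
    x ^+ (\sum_(i < k) n i.+1).
Proof.
(* The block column with entries x^(k-j) A_(j-1) ... A_0 is annihilated by all
   block rows of the matrix but the first one. *)
pose v j : 'M[S]_(n j, n 0%N) := x ^+ (k - j) *: map_mx f (chain_mx A j).
have row0 := block_cyclic_row0 v; have rowS := block_cyclic_rowS v.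
have v0 : v 0%N = (x ^+ k)%:M by rewrite /v subn0 map_mx1 scale_scalar_mx mulr1.
have vk : v k = map_mx f (chain_mx A k) by rewrite /v subnn scale1r.
have vS (i : 'I_k) : map_mx f (A i) *m v i = x *: v i.+1.
  by rewrite /v -scalemxAr -map_mxM scalerA -exprS -subSn ?subSS.
rewrite block_cyclicE mxblock_recul.
rewrite det_scalar_sub_castmx.
rewrite map_block_mx scalar_mx_block opp_block_mx add_block_mx !sub0r.
(* The power of [x] on the left is the determinant of the top block [v 0] of the column. *)
rewrite exprM -(@det_scalar S (n 0%N)) -v0.
have map_row : map_mx f (\mxrow_j B ord0 (lift ord0 j))
    = \mxrow_j map_mx f (B ord0 (lift ord0 j)) by apply/matrixP => ? ?; rewrite !mxE.
have map_col : map_mx f (\mxcol_i B (lift ord0 i) ord0)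
    = \mxcol_i map_mx f (B (lift ord0 i) ord0) by apply/matrixP => ? ?; rewrite !mxE.
have map_block : map_mx f (\mxblock_(i, j) B (lift ord0 i) (lift ord0 j))
    = \mxblock_(i, j) map_mx f (B (lift ord0 i) (lift ord0 j)).
  by apply/matrixP => ? ?; rewrite !mxE.
rewrite (@det_block_mul _ _ _ _ _ _ _ _ (\mxcol_(i < k) v (lift ord0 i))).
  (* Without its first block row and column the cyclic matrix is strictly lower triangular, so this
     minor is a power of [x]. *)
  rewrite det_scalar_sub_strict_trig.
    congr (\det _ * _).
    move: row0; rewrite big_ord_recl vk -map_mxM => <-.
    rewrite mulmxBl mulNmx mul_scalar_mx.
    rewrite {1}v0 scale_scalar_mx -exprS opprD addrA; congr (_ - _ - _).
    by rewrite map_row mul_mxrow_mxcol.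
  move=> i j leij; rewrite !mxE.
  by rewrite cyclic_block_strict_trig ?mxE ?rmorph0 //; apply: tagnat.le_sig1.
apply/eqP; rewrite mulNmx mulmxBl addrCA -opprD subr_eq0 mul_scalar_mx eq_sym.
rewrite map_col map_block mxcol_mul mul_mxblock_mxrow -mxcolD; apply/eqP.
apply/matrixP => i j; rewrite !mxE.
have := rowS (tagnat.sig1 i); rewrite vS big_ord_recl /=.
by move=> /matrixP/(_ (tagnat.sig2 i) j); rewrite !mxE => ->.
Qed.
End BlockCyclic.

(** * Kemeny's constant as a function of a polynomial *)

Definition simple_root1 (F : fieldType) (p : {poly F}) : Prop :=
  p.[1] = 0 /\ p^`().[1] != 0.

(* If p = (X - 1) g with g(1) <> 0, this is g'(1) / g(1), the logarithmic
   derivative of the product over the roots other than 1. *)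
Definition kemeny_poly (F : fieldType) (p : {poly F}) : F :=
  p^`()^`().[1] / (2 * p^`().[1]).

Lemma horner1_mulXn (F : fieldType) (p : {poly F}) m : (p * 'X^m).[1] = p.[1].
Proof. by rewrite hornerM hornerXn expr1n mulr1. Qed.

Lemma deriv1_mulXn (F : fieldType) (p : {poly F}) m :
  (p * 'X^m)^`().[1] = p^`().[1] + p.[1] *+ m.
Proof.
by rewrite derivM derivXn hornerD horner1_mulXn mulrnAr hornerMn horner1_mulXn.
Qed.

Lemma deriv2_mulXn (F : fieldType) (p : {poly F}) m : p.[1] = 0 ->
  (p * 'X^m)^`()^`().[1] = p^`()^`().[1] + p^`().[1] *+ m *+ 2.
Proof.
move=> p1; rewrite derivM derivXn derivD hornerD deriv1_mulXn mulrnAr.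
by rewrite derivMn hornerMn deriv1_mulXn p1 mul0rn addr0 -addrA mulr2n.
Qed.

Lemma horner1_compXn (F : fieldType) (p : {poly F}) m :
  (p \Po 'X^m).[1] = p.[1].
Proof. by rewrite horner_comp hornerXn expr1n. Qed.

Lemma deriv_compXn (F : fieldType) (p : {poly F}) m :
  (p \Po 'X^m)^`() = (p^`() \Po 'X^m) * 'X^(m.-1) *+ m.
Proof. by rewrite deriv_comp derivXn mulrnAr. Qed.

Lemma simple_root1_mulXn (F : fieldType) (p : {poly F}) m :
  simple_root1 (p * 'X^m) <-> simple_root1 p.
Proof.
rewrite /simple_root1 horner1_mulXn deriv1_mulXn.
by split=> -[p1]; rewrite p1 mul0rn addr0.
Qed.

Lemma simple_root1_compXn (F : numFieldType) (p : {poly F}) m :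
  simple_root1 (p \Po 'X^(m.+1)) <-> simple_root1 p.
Proof.
rewrite /simple_root1 horner1_compXn deriv_compXn hornerMn horner1_mulXn.
by rewrite horner1_compXn mulrn_eq0.
Qed.

(** Each of the [m] added roots 0 contributes 1/(1 - 0). *)
Lemma kemeny_poly_mulXn (F : numFieldType) (p : {poly F}) m :
  simple_root1 p -> kemeny_poly (p * 'X^m) = kemeny_poly p + m%:R.
Proof.
move=> [p1 dp1]; rewrite /kemeny_poly deriv2_mulXn // deriv1_mulXn p1 mul0rn addr0.
by field.
Qed.

(** With M = m + 1, the first two derivatives of the composite at 1 are M p'(1) and M^2 p''(1) + M m
    p'(1). *)
Lemma kemeny_poly_compXn (F : numFieldType) (p : {poly F}) m :
  simple_root1 p ->
  kemeny_poly (p \Po 'X^(m.+1)) = m.+1%:R * kemeny_poly p + m%:R / 2.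
Proof.
move=> [p1 dp1]; rewrite /kemeny_poly deriv_compXn derivMn !hornerMn horner1_mulXn.
rewrite deriv1_mulXn deriv_compXn hornerMn horner1_mulXn !horner1_compXn.
field.
by rewrite dp1 nat1r pnatr_eq0.
Qed.

Lemma deriv_prod_XsubC (F : fieldType) (s : seq F) x : x \notin s ->
  (\prod_(z <- s) ('X - z%:P))^`().[x] =
  (\prod_(z <- s) ('X - z%:P)).[x] * \sum_(z <- s) (x - z)^-1.
Proof.
elim: s => [|z s IHs]; first by rewrite !big_nil derivC horner0 mulr0.
rewrite inE negb_or => /andP[nexz /IHs{}IHs].
rewrite !big_cons derivM derivXsubC mul1r hornerD !hornerM IHs hornerXsubC.
have : x - z != 0 by rewrite subr_eq0.
by move=> ?; field.
Qed.

Lemma kemeny_poly_prod (F : numFieldType) (s : seq F) :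
  simple_root1 (\prod_(z <- s) ('X - z%:P)) ->
  kemeny_poly (\prod_(z <- s) ('X - z%:P)) = \sum_(z <- rem 1 s) (1 - z)^-1.
Proof.
move=> [/rootP]; rewrite root_prod_XsubC => /perm_to_rem s1.
rewrite /kemeny_poly (perm_big _ s1) /= big_cons.
set g := \prod_(z <- rem 1 s) _.
have dE : (('X - 1%:P) * g)^`() = g + ('X - 1%:P) * g^`().
  by rewrite derivM derivXsubC mul1r.
have d1 : (('X - 1%:P) * g)^`().[1] = g.[1].
  by rewrite dE hornerD hornerM hornerXsubC subrr mul0r addr0.
rewrite d1 => g1.
have d2 : (('X - 1%:P) * g)^`()^`().[1] = 2 * g^`().[1].
  rewrite dE derivD derivM derivXsubC mul1r !hornerD hornerM hornerXsubC subrr mul0r.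
  by rewrite addr0 mulr_natl mulr2n.
(* That g(1) is nonzero means that 1 is absent from [rem 1 s], so the logarithmic derivative formula
   applies. *)
rewrite d2 deriv_prod_XsubC -/g; last first.
  by rewrite -root_prod_XsubC.
by field.
Qed.

Lemma simple_root1_map (F G : fieldType) (f : {rmorphism F -> G}) (p : {poly F}) :
  simple_root1 p -> simple_root1 (map_poly f p).
Proof.
move=> [p1 dp1]; rewrite /simple_root1 deriv_map -(rmorph1 f) !horner_map p1.
by rewrite rmorph0 fmorph_eq0.
Qed.

Lemma kemeny_poly_map (F G : fieldType) (f : {rmorphism F -> G}) (p : {poly F}) :
  kemeny_poly (map_poly f p) = f (kemeny_poly p).
Proof.
have fE (q : {poly F}) : (map_poly f q).[1] = f q.[1].
  by rewrite -[1 in LHS](rmorph1 f) horner_map.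
by rewrite /kemeny_poly !deriv_map !fE fmorph_div rmorphM rmorph_nat.
Qed.

(** This moves the computation from eigenvalues in [R[i]] to the real characteristic polynomial. *)
Lemma kemenyE (R : realType) (N : nat) (Q : 'M[R]_N) :
  simple_root1 (char_poly Q) ->
  kemeny Q = real_complex R (kemeny_poly (char_poly Q)).
Proof.
move=> /(simple_root1_map (real_complex R)).
rewrite -kemeny_poly_map map_char_poly /kemeny /eigenvalues.
case: closed_field_poly_normal => s /=.
rewrite (monicP (char_poly_monic _)) scale1r => -> s1.
by rewrite kemeny_poly_prod.
Qed.

(** * Maximum principle for stochastic matrices *)

Lemma stochastic_sum (R : realType) (m n : nat) (A : 'M[R]_(m, n)) i :
  stochastic A -> \sum_j A i j = 1.
Proof.
move=> [_ /matrixP/(_ i 0)]; rewrite !mxE => <-.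
by apply: eq_bigr => j _; rewrite mxE mulr1.
Qed.

Lemma stochastic_exp (R : realType) (N : nat) (P : 'M[R]_N) k :
  stochastic P -> stochastic (P ^+ k).
Proof.
move=> [P_ge0 P1]; elim: k => [|k [Pk_ge0 Pk1]].
  by rewrite expr0; split=> [i j|]; rewrite ?mul1mx // !mxE ler0n.
rewrite exprS; split=> [i j|]; last by rewrite -mulmxA Pk1.
by rewrite !mxE; apply: sumr_ge0 => l _; rewrite mulr_ge0.
Qed.

Lemma max_entry (R : realType) (N : nat) (v : 'cV[R]_N.+1) :
  exists i, forall j, v j 0 <= v i 0.
Proof.
case: (arg_maxP (fun i => v i 0) (erefl (xpredT (0 : 'I_N.+1)))) => i _ vi.
by exists i => j; exact: vi.
Qed.

(** The maximum [v i 0] is a weighted average of entries of [v], so every entry of positive weight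
    attains it. *)
Lemma stochastic_harmonic_max (R : realType) (N : nat) (P : 'M[R]_N)
    (v : 'cV[R]_N) i j :
  stochastic P -> P *m v = v -> (forall l, v l 0 <= v i 0) -> 0 < P i j ->
  v j 0 = v i 0.
Proof.
move=> stP Pv vi Pij.
have : \sum_l P i l * (v i 0 - v l 0) = 0.
  under eq_bigr do rewrite mulrBr.
  rewrite sumrB -mulr_suml stochastic_sum // mul1r.
  by move/matrixP: Pv => /(_ i 0); rewrite !mxE => ->; rewrite subrr.
move/eqP; rewrite psumr_eq0 => [|l _]; last first.
  by rewrite mulr_ge0 ?stP.1 // subr_ge0.
move=> /allP/(_ j); rewrite mem_index_enum => /(_ isT).
by rewrite mulf_eq0 gt_eqF //= subr_eq0 => /eqP.
Qed.

(** A vector harmonic for [P] is harmonic for its powers, and from a maximal entry some power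
    reaches any given state. *)
Lemma irreducible_harmonic_const (R : realType) (N : nat) (P : 'M[R]_N.+1)
    (v : 'cV[R]_N.+1) i j :
  stochastic P -> irreducible P -> P *m v = v -> v i 0 = v j 0.
Proof.
move=> stP irP Pv; have [l vl] := max_entry v.
suff vE h : v h 0 = v l 0 by rewrite !vE.
have [k Pk] := irP l h.
apply: (@stochastic_harmonic_max _ _ (P ^+ k)) => //; first exact: stochastic_exp.
by elim: k {Pk} => [|k IHk]; rewrite ?mul1mx // exprS -mulmxA IHk.
Qed.

Lemma stochastic_drift_le0 (R : realType) (N : nat) (P : 'M[R]_N.+1)
    (v : 'cV[R]_N.+1) (c : R) :
  stochastic P -> P *m v = v + const_mx c -> c <= 0.
Proof.
move=> stP /matrixP Pv; have [l vl] := max_entry v.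
have := Pv l 0; rewrite !mxE => Pvl.
suff : \sum_j P l j * v j 0 <= v l 0 by rewrite Pvl; lra.
rewrite -[leRHS]mul1r -(@stochastic_sum _ _ _ P l) // mulr_suml.
by apply: ler_sum => j _; rewrite ler_wpM2l ?stP.1.
Qed.

Lemma stochastic_drift0 (R : realType) (N : nat) (P : 'M[R]_N.+1)
    (v : 'cV[R]_N.+1) (c : R) :
  stochastic P -> P *m v = v + const_mx c -> c = 0.
Proof.
move=> stP Pv; apply/eqP; rewrite eq_le (stochastic_drift_le0 stP Pv).
(* The vector [- v] has drift [- c], which gives the opposite bound. *)
rewrite -oppr_le0 (@stochastic_drift_le0 _ _ P (- v)) //.
by rewrite mulmxN Pv opprD; congr (_ + _); apply/matrixP => i j; rewrite !mxE.
Qed.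

(** * Simplicity of the eigenvalue 1 *)

Lemma horner_char_poly (R : comNzRingType) (N : nat) (A : 'M[R]_N) x :
  (char_poly A).[x] = \det (x%:M - A).
Proof.
rewrite -[LHS]/(horner_eval x _) -det_map_mx; congr (\det _).
apply/matrixP => i j; rewrite !mxE /= /horner_eval.
by rewrite hornerD hornerN hornerMn hornerX hornerC.
Qed.

(* Conjugation by the shear S, whose first column is the all-ones vector,
   makes P block upper triangular. *)
Lemma char_poly_deflate (R : comNzRingType) (N : nat) (P : 'M[R]_(1 + N)) :
  P *m (const_mx 1 : 'cV_(1 + N)) = const_mx 1 ->
  char_poly P = ('X - 1%:P) *
    char_poly (drsubmx P - (const_mx 1 : 'cV_N) *m ursubmx P).
Proof.
set r := ursubmx P => P1; set B := drsubmx P - _.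
pose S : 'M[R]_(1 + N) := block_mx 1%:M 0 (const_mx 1) 1%:M.
pose T : 'M[R]_(1 + N) := block_mx 1%:M r 0 B.
have const_mx1_scalar : const_mx 1 = 1%:M :> 'M[R]_1 by rewrite [LHS]mx11_scalar mxE.
have PS : P *m S = S *m T.
  move: P1; rewrite -col_mx_const /S /T -(submxK P) mul_block_col !mulmx_block.
  move=> /eq_col_mx[]; rewrite !(mulmx1, const_mx1_scalar) => -> ->.
  rewrite !(mulmx0, mulmx1, mul1mx, mul0mx, addr0, add0r).
  by rewrite addrCA subrr addr0.
have detS : \det (map_mx polyC S) = 1 by rewrite det_map_mx det_lblock !det1 mulr1.
have -> : char_poly P = char_poly T.
  rewrite /char_poly /char_poly_mx -[LHS]mulr1 -[RHS]mul1r -detS -!det_mulmx.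
  by rewrite mulmxBl mulmxBr -!map_mxM PS scalar_mxC.
rewrite /char_poly /char_poly_mx /T map_block_mx map_mx0 scalar_mx_block.
rewrite opp_block_mx add_block_mx oppr0 addr0 det_ublock map_mx1 -raddfB.
by rewrite det_scalar1.
Qed.

Lemma irreducible_simple_root1 (R : realType) (N : nat) (P : 'M[R]_N) :
  (0 < N)%N -> stochastic P -> irreducible P -> simple_root1 (char_poly P).
Proof.
case: N P => // N; rewrite -[N.+1]/(1 + N)%N => P _ stP irP.
have chiP := char_poly_deflate stP.2.
rewrite chiP /simple_root1 derivM derivXsubC mul1r hornerD !hornerM hornerXsubC.
rewrite subrr !mul0r addr0; split=> //.
(* After deflation the derivative at 1 is det(1 - B), with B the deflated block. [det0P] yields left
   kernel vectors, hence the transpose. *)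
rewrite horner_char_poly -det_tr; apply/det0P => -[w /eqP w0].
rewrite -{1}(trmxK w) -trmx_mul => /(canRL (@trmxK _ _ _)); rewrite trmx0.
set u := w^T; rewrite mulmxBl mul1mx mulmxBl opprB addrCA => /eqP.
rewrite addr_eq0 opprB => /eqP Bu.
(* Padding a fixed vector [u] of B with 0 gives a vector of constant drift [c] under [P]. It is
   therefore harmonic and constant, and its first entry makes it zero. *)
pose v : 'cV[R]_(1 + N) := col_mx 0 u.
pose c := (ursubmx P *m u) 0 0.
have qu : ursubmx P *m u = const_mx c.
  by rewrite [LHS]mx11_scalar -/c; apply/matrixP => i j; rewrite !ord1 !mxE.
have Pv : P *m v = v + const_mx c.
  rewrite -[P in LHS]submxK mul_block_col !mulmx0 !add0r qu.
  rewrite -col_mx_const add_col_mx add0r; congr col_mx.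
  rewrite -[LHS](subrK u) -Bu -mulmxA qu addrC; congr (_ + _).
  by apply/matrixP => i j; rewrite !mxE big_ord1 !mxE mul1r.
have c0 := stochastic_drift0 stP Pv.
have v_top : v (lshift N (0 : 'I_1)) 0 = 0 by rewrite col_mxEu mxE.
have Pv0 : P *m v = v by rewrite Pv c0 addr0.
have v0 i : v i 0 = 0.
  exact: etrans (irreducible_harmonic_const _ _ stP irP Pv0) v_top.
apply: w0; rewrite -(trmxK w) -/u -trmx0; congr _^T.
by apply/matrixP => i j; rewrite ord1 -(col_mxEd (0 : 'cV_1)) v0 mxE.
Qed.

(** * Characteristic polynomials of the cyclic products, and the conclusion *)

Lemma char_poly_comp (R : comNzRingType) (N : nat) (A : 'M[R]_N) (q : {poly R}) :
  char_poly A \Po q = \det (q%:M - map_mx polyC A).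
Proof.
rewrite -det_map_mx; congr (\det _); apply/matrixP => i j.
by rewrite !mxE /= comp_polyB comp_polyC rmorphMn /= comp_polyX.
Qed.

Lemma char_poly_block_cyclic (R : realType) (n : nat -> nat) (k : nat)
    (A : forall j : nat, 'M[R]_(n j.+1, n j)) (C : 'M[R]_(n 0%N, n k)) :
  char_poly (block_cyclic A C) * 'X^(k * n 0%N) =
  (char_poly (C *m chain_mx A k) \Po 'X^(k.+1)) * 'X^(\sum_(i < k) n i.+1).
Proof. by rewrite char_poly_comp -(det_block_cyclic polyC). Qed.

(** Splitting off the rightmost factor leaves the chain of shifted blocks that occurs in [P2]. *)
Lemma chain_mxSr (R : realType) (n : nat -> nat)
    (A : forall j : nat, 'M[R]_(n j.+1, n j)) (k : nat) :
  chain_mx A k.+1 =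
  chain_mx (n := fun i => n i.+1) (fun j => A j.+1) k *m A 0%N.
Proof. by elim: k => [|k IHk]; rewrite /= ?mulmx1 ?mul1mx // -mulmxA -IHk. Qed.

Unset Implicit Arguments.

(* The number of blocks is d = k.+2; with blocks numbered from 0, [A j] is
   A_{j+1} for j < d - 1 and [Ad] is A_d. *)
Theorem proposition4p1 (R : realType) (k : nat) (n : nat -> nat)
    (A : forall j : nat, 'M[R]_(n j.+1, n j)) (Ad : 'M[R]_(n 0%N, n k.+1))
    (P : 'M[R]_(\sum_(i < k.+2) n i))
    (P1 : 'M[R]_(n 0%N))
    (P2 : 'M[R]_(\sum_(i < k.+1) n i.+1))
    (n_gt0 : forall i : nat, (i < k.+2)%N -> (0 < n i)%N)
    (A_stochastic : forall j : nat, (j < k.+1)%N -> stochastic (A j))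
    (Ad_stochastic : stochastic Ad)
    (P_def : P = block_cyclic A Ad)
    (P_stochastic : stochastic P)
    (P_irreducible : irreducible P)
    (P_periodic : periodic P)
    (P1_def : P1 = Ad *m chain_mx A k.+1)
    (P2_def : P2 = block_cyclic (n := fun i => n i.+1)
                     (fun j => A j.+1) (A 0%N *m Ad)) :
  kemeny P = kemeny P1 + kemeny P2 + 2^-1.
Proof.
pose n' i := n i.+1; pose A' j : 'M_(n' j.+1, n' j) := A j.+1.
(* The cyclic products of [P] and [P2] are [W *m A 0] and [A 0 *m W], so Sylvester's identity
   relates them. *)
pose W := Ad *m chain_mx A' k.
have P1E : P1 = W *m A 0%N by rewrite P1_def chain_mxSr mulmxA.
set chi1 := char_poly P1.
have sumE : (\sum_(i < k.+1) n i.+1 = n 1 + \sum_(i < k) n i.+2)%N.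
  by rewrite big_ord_recl.
have chiP : char_poly P * 'X^(k.+1 * n 0%N) =
    (chi1 \Po 'X^(k.+2)) * 'X^(n 1 + \sum_(i < k) n i.+2).
  by rewrite -sumE P_def char_poly_block_cyclic -P1_def.
have chiP2 : char_poly P2 * 'X^(k * n 1%N) * 'X^(k.+1 * n 0%N) =
    (chi1 \Po 'X^(k.+1)) * 'X^(k.+1 * n 1%N) * 'X^(\sum_(i < k) n i.+2).
  rewrite P2_def (@char_poly_block_cyclic _ n') mulrAC; congr (_ * _).
  rewrite -mulmxA /chi1 P1E !char_poly_comp !map_mxM !exprM.
  exact: det_scalar_mulC.
have chi_simple : simple_root1 (char_poly P).
  apply: irreducible_simple_root1 => //.
  by rewrite big_ord_recl addn_gt0 n_gt0.
have chi1_simple : simple_root1 chi1.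
  rewrite -(simple_root1_compXn _ k.+1).
  rewrite -(simple_root1_mulXn _ (n 1 + \sum_(i < k) n i.+2)) -chiP.
  by rewrite simple_root1_mulXn.
have chi2_simple : simple_root1 (char_poly P2).
  rewrite -(simple_root1_mulXn _ (k * n 1%N)).
  rewrite -(simple_root1_mulXn _ (k.+1 * n 0%N)) chiP2.
  by rewrite !simple_root1_mulXn simple_root1_compXn.
(* In the difference of the two equations all block sizes cancel, the multiples [k.+2] and [k.+1]
   leave one constant of [P1], and (k+1)/2 - k/2 gives the 1/2. *)
have := congr1 (@kemeny_poly _) chiP; have := congr1 (@kemeny_poly _) chiP2.
rewrite !(kemeny_poly_mulXn, kemeny_poly_compXn) ?simple_root1_mulXn ?simple_root1_compXn //.
rewrite -/chi1 => kem2 kem.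
rewrite !kemenyE // -rmorphD.
have -> : 2^-1 = real_complex R 2^-1 by rewrite fmorphV rmorph_nat.
rewrite -rmorphD; congr (real_complex R _).
move: kem kem2; rewrite -/chi1 !natrM natrD -!natr1 !mulrDl !mul1r.
by lra.
Qed.
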